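(* Let $m>0$. For real $\varepsilon$ consider $2\pi$-periodic real solutions $y(\tau)$ of $$y'''+4y'+\varepsilon\, y^{-5/2}\cos\tau=0$$ with mean value $$\frac{1}{2\pi}\int_0^{2\pi}y(\tau)\,d\tau=m .$$ Then, for $\varepsilon\neq 0$ and $C_1\neq 0$, no such solution bifurcates from the constant state $y\equiv m$. That is, there do not exist a sequence of parameter values $\varepsilon_k\neq0$ (arising from constants with $C_1\neq 0$) with $\varepsilon_k\to0$ and $2\pi$-periodic solutions $y_k$ of the equation with $\varepsilon=\varepsilon_k$, each of mean value $m$, such that $y_k\to m$ uniformly as $k\to\infty$.
   Context: Primes denote derivatives with respect to $\tau$. Solutions are strictly positive, so that $y^{-5/2}$ is real. The parameter is $\varepsilon=C/\omega^3$ with $C=\sqrt{C_1^2+C_2^2}$, where $C_1,C_2$ and $\omega\neq0$ are real constants; the equation is the rescaled form (with $\tau=\omega t$, up to a constant phase shift of $\tau$) of an equation whose forcing is $C_1\cos(\omega t)+C_2\sin(\omega t)$. For the equation in $\tau$ only the value of $\varepsilon$ matters. *)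

(* Defs.v *)
From Stdlib Require Import Reals Lra.
From Coquelicot Require Import Coquelicot.
Open Scope R_scope.

(* Coquelicot's [ex_derive_n y 3] alone does not imply that the lower-order
   derivatives exist, hence the quantification over all [n <= 3]. *)
Definition thrice_differentiable (y : R -> R) : Prop :=
  forall (n : nat) (t : R), (n <= 3)%nat -> ex_derive_n y n t.

(* [Rpower] is the genuine real power only on positive bases, which is why
   positivity is part of the notion of solution. *)
Definition is_solution (eps : R) (y : R -> R) : Prop :=
  (forall t : R, 0 < y t) /\
  thrice_differentiable y /\
  (forall t : R,
     Derive_n y 3 t + 4 * Derive_n y 1 t
       + eps * Rpower (y t) (- (5 / 2)) * cos t = 0).

Definition periodic_2PI (y : R -> R) : Prop :=
  forall t : R, y (t + 2 * PI) = y t.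

Definition mean_value (y : R -> R) : R :=
  / (2 * PI) * RInt y 0 (2 * PI).

Definition parameter (C1 C2 omega : R) : R :=
  sqrt (C1 ^ 2 + C2 ^ 2) / omega ^ 3.

(* The constants may differ from one parameter value to another. *)
Definition admissible_parameter (eps : R) : Prop :=
  exists C1 C2 omega : R,
    C1 <> 0 /\ omega <> 0 /\ eps = parameter C1 C2 omega.

Definition converges_uniformly_to_const (y : nat -> R -> R) (m : R) : Prop :=
  forall delta : R, 0 < delta ->
    exists N : nat, forall k : nat, (N <= k)%nat ->
      forall t : R, Rabs (y k t - m) < delta.

Definition bifurcates_from_constant (m : R) : Prop :=
  exists (eps : nat -> R) (y : nat -> R -> R),
    (forall k : nat, eps k <> 0 /\ admissible_parameter (eps k)) /\
    is_lim_seq eps 0 /\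
    (forall k : nat,
       is_solution (eps k) (y k) /\ periodic_2PI (y k) /\
       mean_value (y k) = m) /\
    converges_uniformly_to_const y m.

(* Main.v *)
Require Import Defs.
From Stdlib Require Import Reals Lra IndefiniteDescription.
From Coquelicot Require Import Coquelicot.
Open Scope R_scope.

(** Let [F = y^(-5/2)] and split off the [PI]-antiperiodic part
    [u t = y t - y (t + PI)], which solves
    [u''' + 4 u' = - eps cos t (F t + F (t + PI))].  The operator [D^3 + 4 D]
    is boundedly invertible on [PI]-antiperiodic functions, because its kernel
    [1, cos 2t, sin 2t] is [PI]-periodic; hence
    [u = - (2/3) eps m^(-5/2) sin t + o(eps)] when [y] is uniformly close to
    [m].  Solvability against [sin 2t] makes the integral over a half period of
    [cos t sin 2t (F t - F (t + PI))] vanish, whereas by the mean value theorem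
    this integrand is [(5/6) eps m^(-6) sin(2t)^2 + o(eps)]. *)

(** * Half-period estimates and inversion of [D^3 + 4 D] *)

Lemma increment_bound (f df : R -> R) (M : R)
  (Hf : forall t, is_derive f t (df t)) (HM : forall t, Rabs (df t) <= M) (t : R) :
  Rabs (f (t + PI) - f t) <= M * PI.
Proof.
  pose proof PI_RGT_0 as Hpi.
  destruct (MVT_gen f t (t + PI) df) as [c [_ Hc]].
  - intros x _; apply Hf.
  - intros x _; apply continuity_pt_filterlim.
    apply (ex_derive_continuous f); eexists; apply Hf.
  - rewrite Hc, Rabs_mult.
    replace (t + PI - t) with PI by ring.
    rewrite (Rabs_pos_eq PI) by lra.
    apply Rmult_le_compat_r; [lra | apply HM].
Qed.

(** Here the increment over [PI] is [- 2 * f t], which gives the bound [M * PI / 2]; the factor 2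
    comes from [PI <= 4]. *)
Lemma antiperiodic_bound (f df : R -> R) (M : R)
  (Hf : forall t, is_derive f t (df t)) (HM : forall t, Rabs (df t) <= M)
  (Ha : forall t, f (t + PI) = - f t) (t : R) :
  Rabs (f t) <= 2 * M.
Proof.
  pose proof (increment_bound f df M Hf HM t) as H.
  rewrite Ha in H.
  pose proof PI_4 as H4.
  pose proof (Rle_trans _ _ _ (Rabs_pos _) (HM 0)) as HM0.
  assert (M * PI <= M * 4) by (apply Rmult_le_compat_l; lra).
  apply Rabs_le_between in H; apply Rabs_le_between; lra.
Qed.

Lemma is_derive_periodic (f df : R -> R) (p : R)
  (Hf : forall t, is_derive f t (df t)) (Hp : forall t, f (t + p) = f t) (t : R) :
  df (t + p) = df t.
Proof.
  assert (H : is_derive (fun x => f (x + p)) t (df (t + p))).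
  { evar_last.
    - apply (is_derive_comp f (fun x => x + p)); [apply Hf | auto_derive; trivial].
    - simpl; unfold scal; simpl; unfold mult; simpl; ring. }
  apply is_derive_unique in H.
  rewrite <- H, <- (is_derive_unique _ _ _ (Hf t)).
  apply Derive_ext, Hp.
Qed.

Lemma Rabs_mult_sin (a x : R) : Rabs (a * sin x) <= Rabs a.
Proof.
  rewrite Rabs_mult; rewrite <- (Rmult_1_r (Rabs a)) at 2.
  apply Rmult_le_compat_l; [apply Rabs_pos |].
  apply Rabs_le_between; pose proof (SIN_bound x); lra.
Qed.

Lemma Rabs_mult_cos (a x : R) : Rabs (a * cos x) <= Rabs a.
Proof.
  rewrite Rabs_mult; rewrite <- (Rmult_1_r (Rabs a)) at 2.
  apply Rmult_le_compat_l; [apply Rabs_pos |].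
  apply Rabs_le_between; pose proof (COS_bound x); lra.
Qed.

Lemma sin_double_shift (t : R) : sin (2 * (t + PI)) = sin (2 * t).
Proof.
  replace (2 * (t + PI)) with (2 * t + 2 * PI) by ring.
  rewrite sin_plus, sin_2PI, cos_2PI; ring.
Qed.

Lemma cos_double_shift (t : R) : cos (2 * (t + PI)) = cos (2 * t).
Proof.
  replace (2 * (t + PI)) with (2 * t + 2 * PI) by ring.
  rewrite cos_plus, sin_2PI, cos_2PI; ring.
Qed.

(** The functions under [Derive] may appear eta-expanded, so they are matched with the hypotheses up
    to conversion before the known derivative is substituted. *)
Ltac derive_with :=
  auto_derive;
  [ repeat split; trivial; eexists; eauto
  | repeat match goal with
    | H : forall t, is_derive ?f t _ |- context [Derive ?g ?t] =>
        unify f g;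
        replace (Derive g t) with (Derive f t) by reflexivity;
        rewrite (is_derive_unique _ _ _ (H t))
    end ].

(** Antiperiodicity fixes the constant in each integration. The first integration bounds
    [z2 + 4 * z0] by [2 * d]. The second, against the [PI]-periodic weights [sin 2t] and [cos 2t],
    bounds two combinations of [z0] and [z1] by [4 * d]. *)
Lemma antiperiodic_inverse_bound (z0 z1 z2 z3 : R -> R) (d : R)
  (H0 : forall t, is_derive z0 t (z1 t)) (H1 : forall t, is_derive z1 t (z2 t))
  (H2 : forall t, is_derive z2 t (z3 t))
  (A0 : forall t, z0 (t + PI) = - z0 t) (A1 : forall t, z1 (t + PI) = - z1 t)
  (A2 : forall t, z2 (t + PI) = - z2 t)
  (Hd : forall t, Rabs (z3 t + 4 * z1 t) <= d) (t : R) :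
  Rabs (z0 t) <= 4 * d.
Proof.
  set (q t := z2 t + 4 * z0 t).
  assert (Hq : forall t, Rabs (q t) <= 2 * d).
  { apply antiperiodic_bound with (fun t => z3 t + 4 * z1 t); trivial.
    - intros x; unfold q; derive_with; ring.
    - intros x; unfold q; rewrite A0, A2; ring. }
  (* Variation of constants for [z'' + 4 z = q]. *)
  assert (HS : Rabs (z1 t * sin (2 * t) - 2 * z0 t * cos (2 * t)) <= 2 * (2 * d)).
  { apply (antiperiodic_bound (fun t => z1 t * sin (2 * t) - 2 * z0 t * cos (2 * t))
      (fun t => q t * sin (2 * t))).
    - intros x; unfold q; derive_with; ring.
    - intros x; eapply Rle_trans; [apply Rabs_mult_sin | apply Hq].
    - intros x; rewrite A0, A1, sin_double_shift, cos_double_shift; ring. }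
  assert (HC : Rabs (z1 t * cos (2 * t) + 2 * z0 t * sin (2 * t)) <= 2 * (2 * d)).
  { apply (antiperiodic_bound (fun t => z1 t * cos (2 * t) + 2 * z0 t * sin (2 * t))
      (fun t => q t * cos (2 * t))).
    - intros x; unfold q; derive_with; ring.
    - intros x; eapply Rle_trans; [apply Rabs_mult_cos | apply Hq].
    - intros x; rewrite A0, A1, sin_double_shift, cos_double_shift; ring. }
  set (S := z1 t * sin (2 * t) - 2 * z0 t * cos (2 * t)) in *.
  set (C := z1 t * cos (2 * t) + 2 * z0 t * sin (2 * t)) in *.
  (* Rotating by the angle [2t] eliminates [z1]. *)
  assert (E : 2 * z0 t = C * sin (2 * t) - S * cos (2 * t)).
  { pose proof (sin2_cos2 (2 * t)) as H; unfold Rsqr in H; unfold S, C.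
    transitivity (2 * z0 t * (sin (2 * t) * sin (2 * t) + cos (2 * t) * cos (2 * t)));
      [rewrite H |]; ring. }
  pose proof (Rle_trans _ _ _ (Rabs_mult_sin C (2 * t)) HC) as B1.
  pose proof (Rle_trans _ _ _ (Rabs_mult_cos S (2 * t)) HS) as B2.
  apply Rabs_le_between in B1; apply Rabs_le_between in B2.
  apply Rabs_le_between; lra.
Qed.

(** Since [D^3 + 4 D] sends [sin] to [3 cos], the added sine cancels the forcing [- 2 eps s cos t]
    obtained by replacing [F] with [s]. The remaining forcing is at most [2 |eps| eta], and the
    inverse costs a factor 4. *)
Lemma antiperiodic_part_bound (y0 y1 y2 y3 F : R -> R) (eps s eta : R)
  (H0 : forall t, is_derive y0 t (y1 t)) (H1 : forall t, is_derive y1 t (y2 t))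
  (H2 : forall t, is_derive y2 t (y3 t))
  (Hp : forall t, y0 (t + 2 * PI) = y0 t)
  (Heq : forall t, y3 t + 4 * y1 t + eps * F t * cos t = 0)
  (HF : forall t, Rabs (F t - s) <= eta) (t : R) :
  Rabs (y0 t - y0 (t + PI) + 2 / 3 * s * eps * sin t) <= 8 * (Rabs eps * eta).
Proof.
  pose proof (is_derive_periodic _ _ _ H0 Hp) as Hp1.
  pose proof (is_derive_periodic _ _ _ H1 Hp1) as Hp2.
  assert (Hs : forall x, sin (x + PI) = - sin x) by (intro; apply neg_sin).
  assert (Hc : forall x, cos (x + PI) = - cos x) by (intro; apply neg_cos).
  assert (H2pi : forall x, x + PI + PI = x + 2 * PI) by (intro; ring).
  replace (8 * (Rabs eps * eta)) with (4 * (2 * (Rabs eps * eta))) by ring.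
  apply (antiperiodic_inverse_bound
    (fun t => y0 t - y0 (t + PI) + 2 / 3 * s * eps * sin t)
    (fun t => y1 t - y1 (t + PI) + 2 / 3 * s * eps * cos t)
    (fun t => y2 t - y2 (t + PI) - 2 / 3 * s * eps * sin t)
    (fun t => y3 t - y3 (t + PI) - 2 / 3 * s * eps * cos t)).
  - intros x; derive_with; ring.
  - intros x; derive_with; ring.
  - intros x; derive_with; ring.
  - intros x; rewrite H2pi, Hp, Hs; ring.
  - intros x; rewrite H2pi, Hp1, Hc; ring.
  - intros x; rewrite H2pi, Hp2, Hs; ring.
  - intros x.
    pose proof (Heq x) as E1; pose proof (Heq (x + PI)) as E2.
    rewrite Hc in E2.
    replace (_ + _) with
      (- (eps * ((F x - s) + (F (x + PI) - s))) * cos x) by lra.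
    eapply Rle_trans; [apply Rabs_mult_cos |].
    rewrite Rabs_Ropp, Rabs_mult.
    replace (2 * (Rabs eps * eta)) with (Rabs eps * (eta + eta)) by ring.
    apply Rmult_le_compat_l; [apply Rabs_pos |].
    eapply Rle_trans; [apply Rabs_triang | apply Rplus_le_compat; apply HF].
Qed.

(** [K] is minus the difference quotient of the nonlinearity between [y0 t] and [y0 (t + PI)]. After
    division by [eps ^ 2], the left side is the mean of [(s kappa / 3) sin(2t)^2] and the right side
    bounds the errors. *)
Lemma solvability_estimate (y0 y1 y2 y3 F K : R -> R) (eps s kappa eta : R)
  (Heps : eps <> 0) (Hs0 : 0 < s) (Hk0 : 0 < kappa)
  (H0 : forall t, is_derive y0 t (y1 t)) (H1 : forall t, is_derive y1 t (y2 t))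
  (H2 : forall t, is_derive y2 t (y3 t))
  (Hp : forall t, y0 (t + 2 * PI) = y0 t)
  (Heq : forall t, y3 t + 4 * y1 t + eps * F t * cos t = 0)
  (HF : forall t, Rabs (F t - s) <= eta)
  (HFK : forall t, F t - F (t + PI) = - K t * (y0 t - y0 (t + PI)))
  (HK : forall t, Rabs (K t - kappa) <= eta) :
  s * kappa / 6 <= eta * (s / 3 + 8 * (kappa + eta)).
Proof.
  pose proof (antiperiodic_part_bound _ _ _ _ _ _ _ _ H0 H1 H2 Hp Heq HF) as Hz.
  pose proof (is_derive_periodic _ _ _ H0 Hp) as Hp1.
  pose proof (is_derive_periodic _ _ _ H1 Hp1) as Hp2.
  assert (Heta : 0 <= eta) by exact (Rle_trans _ _ _ (Rabs_pos _) (HK 0)).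
  pose proof PI_RGT_0 as Hpi.
  set (z t := y0 t - y0 (t + PI) + 2 / 3 * s * eps * sin t) in Hz.
  (* The first two summands form a [PI]-periodic function, since
     [y'' sin 2t - 2 y' cos 2t] is a primitive of [(y''' + 4 y') sin 2t]. *)
  pose (P t := (y2 t + y2 (t + PI)) * sin (2 * t)
               - 2 * (y1 t + y1 (t + PI)) * cos (2 * t)
               + eps ^ 2 * (s * kappa / 3) * (t / 2 - sin (4 * t) / 8)).
  (* Substitute [z t - 2/3 s eps sin t] for the antiperiodic part in [eps K u cos t sin 2t]. The
     last summand of [P], a primitive of a multiple of [sin(2t)^2], then turns [- K] into
     [kappa - K], so only small terms remain. *)
  pose (dP t := eps ^ 2 * (s / 3) * (kappa - K t) * sin (2 * t) * sin (2 * t)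
                + eps * K t * z t * cos t * sin (2 * t)).
  assert (HP : forall t, is_derive P t (dP t)).
  { intros t; unfold P.
    derive_with.
    pose proof (Heq t) as E1; pose proof (Heq (t + PI)) as E2.
    rewrite neg_cos in E2.
    assert (HFt : F t = F (t + PI) - K t * (y0 t - y0 (t + PI)))
      by (pose proof (HFK t); lra).
    assert (E : y3 t + y3 (t + PI) + 4 * (y1 t + y1 (t + PI))
                = eps * K t * (y0 t - y0 (t + PI)) * cos t)
      by (rewrite HFt in E1; lra).
    replace (4 * t) with (2 * (2 * t)) by ring.
    rewrite (cos_2a_sin (2 * t)).
    unfold dP, z.
    replace (2 / 3 * s * eps * sin t) with (s * eps * (2 * sin t) / 3) by field.
    transitivity ((y3 t + y3 (t + PI) + 4 * (y1 t + y1 (t + PI))) * sin (2 * t)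
                  + eps ^ 2 * (s * kappa / 3) * (sin (2 * t) * sin (2 * t)));
      [field | rewrite E, (sin_2a t); field]. }
  assert (HdP : forall t, Rabs (dP t) <= eps ^ 2 * (eta * (s / 3 + 8 * (kappa + eta)))).
  { intros t; unfold dP.
    replace (eps ^ 2 * (eta * (s / 3 + 8 * (kappa + eta)))) with
      (eps ^ 2 * (s / 3) * eta + (Rabs eps * (kappa + eta)) * (8 * (Rabs eps * eta)))
      by (rewrite <- (pow2_abs eps); ring).
    eapply Rle_trans; [apply Rabs_triang | apply Rplus_le_compat].
    - do 2 (eapply Rle_trans; [apply Rabs_mult_sin |]).
      assert (0 <= eps ^ 2 * (s / 3))
        by (apply Rmult_le_pos; [apply pow2_ge_0 | lra]).
      rewrite Rabs_mult, Rabs_minus_sym, (Rabs_pos_eq (_ * _)) by trivial.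
      apply Rmult_le_compat_l; trivial.
    - eapply Rle_trans; [apply Rabs_mult_sin |].
      eapply Rle_trans; [apply Rabs_mult_cos |].
      rewrite 2!Rabs_mult.
      apply Rmult_le_compat; try apply Hz; try apply Rabs_pos.
      + apply Rmult_le_pos; apply Rabs_pos.
      + apply Rmult_le_compat_l; [apply Rabs_pos |].
        pose proof (HK t) as HKt; apply Rabs_le_between in HKt.
        apply Rabs_le_between; lra. }
  pose proof (increment_bound P dP _ HP HdP 0) as H.
  (* Only the term [t / 2] changes over a half period. *)
  assert (HPi : P (0 + PI) - P 0 = eps ^ 2 * (s * kappa / 6) * PI).
  { unfold P; rewrite sin_double_shift, cos_double_shift.
    replace (0 + PI + PI) with (0 + 2 * PI) by ring.
    rewrite Hp1, Hp2.
    replace (4 * (0 + PI)) with (2 * (2 * (0 + PI))) by ring.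
    rewrite (sin_2a (2 * (0 + PI))), sin_double_shift, !Rmult_0_r, sin_0; field. }
  rewrite HPi in H.
  apply (Rle_trans _ _ _ (Rle_abs _)) in H.
  apply Rmult_le_reg_r in H; [| trivial].
  apply Rmult_le_reg_l in H; [trivial | now apply pow2_gt_0].
Qed.

(** * Real powers near [m], and the contradiction *)

Lemma is_derive_Rpower (a x : R) :
  0 < x -> is_derive (fun x => Rpower x a) x (a * Rpower x (a - 1)).
Proof.
  intros Hx; apply is_derive_Reals, derivable_pt_lim_power, Hx.
Qed.

Lemma Rpower_close (a m eta : R) :
  0 < m -> 0 < eta ->
  exists delta, 0 < delta /\
    forall x, Rabs (x - m) < delta -> Rabs (Rpower x a - Rpower m a) < eta.
Proof.
  intros Hm Heta.
  assert (Hc : continuous (fun x => Rpower x a) m).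
  { apply (ex_derive_continuous (fun x => Rpower x a)).
    eexists; apply is_derive_Rpower, Hm. }
  apply filterlim_locally with (eps := mkposreal eta Heta) in Hc.
  destruct Hc as [d Hd].
  exists d; split; [apply cond_pos |].
  exact Hd.
Qed.

Lemma Rpower_difference (a x1 x2 : R) :
  0 < x1 -> 0 < x2 ->
  exists c, Rmin x1 x2 <= c <= Rmax x1 x2 /\
    Rpower x1 a - Rpower x2 a = a * Rpower c (a - 1) * (x1 - x2).
Proof.
  intros Hx1 Hx2.
  assert (Hmin : 0 < Rmin x2 x1) by (apply Rmin_pos; trivial).
  destruct (MVT_gen (fun x => Rpower x a) x2 x1 (fun x => a * Rpower x (a - 1)))
    as [c [Hc E]].
  - intros x Hx; apply is_derive_Rpower; lra.
  - intros x Hx; apply continuity_pt_filterlim.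
    apply (ex_derive_continuous (fun x => Rpower x a)).
    eexists; apply is_derive_Rpower; lra.
  - exists c; split; [| exact E].
    now rewrite Rmin_comm, Rmax_comm.
Qed.

(** As [eta] tends to 0, the right side of [solvability_estimate] vanishes while the left side stays
    fixed and positive. The threshold for [eta], and hence [delta], depends on [m] alone. *)
Lemma periodic_solution_not_close (m : R) :
  0 < m ->
  exists delta, 0 < delta /\
    forall eps y, eps <> 0 -> is_solution eps y -> periodic_2PI y ->
      ~ (forall t, Rabs (y t - m) < delta).
Proof.
  intros Hm.
  set (s := Rpower m (- (5 / 2))).
  set (kappa := 5 / 2 * Rpower m (- (5 / 2) - 1)).
  assert (Hs : 0 < s) by apply exp_pos.
  assert (Hk : 0 < kappa) by (apply Rmult_lt_0_compat; [lra | apply exp_pos]).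
  assert (HA : 0 < s / 3 + 8 * (kappa + 1)) by lra.
  set (A := s / 3 + 8 * (kappa + 1)) in HA.
  assert (Hsk : 0 < s * kappa) by (apply Rmult_lt_0_compat; trivial).
  (* The bound 1 keeps the error factor below [A]; the other makes the error at most
     [s * kappa / 12], half of the main term. *)
  set (eta := Rmin 1 (s * kappa / (12 * A))).
  assert (Heta : 0 < eta).
  { apply Rmin_pos; [lra | apply Rdiv_lt_0_compat; lra]. }
  assert (Heta1 : eta <= 1) by apply Rmin_l.
  assert (HetaA : eta * A <= s * kappa / 12).
  { replace (s * kappa / 12) with (s * kappa / (12 * A) * A) by (field; lra).
    apply Rmult_le_compat_r; [lra | apply Rmin_r]. }
  destruct (Rpower_close (- (5 / 2)) m eta Hm Heta) as [d1 [Hd1 HF]].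
  (* The factor [5 / 2] in [kappa] turns [eta / 3] into [5 / 6 * eta], which is below [eta]. *)
  destruct (Rpower_close (- (5 / 2) - 1) m (eta / 3) Hm) as [d2 [Hd2 HK]]; [lra |].
  exists (Rmin d1 d2); split; [apply Rmin_pos; trivial |].
  intros eps y Heps [Hpos [Hdiff Heq]] Hper Hclose.
  assert (Hder : forall n t, (n <= 2)%nat ->
            is_derive (Derive_n y n) t (Derive_n y (S n) t)).
  { intros n t Hn; apply Derive_correct, (Hdiff (S n) t).
    now apply le_n_S. }
  assert (HKex : forall t, exists k, Rabs (k - kappa) <= eta /\
            Rpower (y t) (- (5 / 2)) - Rpower (y (t + PI)) (- (5 / 2))
              = - k * (y t - y (t + PI))).
  { intros t.
    destruct (Rpower_difference (- (5 / 2)) _ _ (Hpos t) (Hpos (t + PI)))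
      as [c [Hc E]].
    exists (5 / 2 * Rpower c (- (5 / 2) - 1)); split; [| rewrite E; ring].
    assert (Hcm : Rabs (c - m) < d2).
    { pose proof (Rlt_le_trans _ _ _ (Hclose t) (Rmin_r d1 d2)) as C1.
      pose proof (Rlt_le_trans _ _ _ (Hclose (t + PI)) (Rmin_r d1 d2)) as C2.
      apply Rabs_lt_between in C1; apply Rabs_lt_between in C2.
      apply Rabs_lt_between.
      revert Hc; unfold Rmin, Rmax; destruct Rle_dec; lra. }
    pose proof (HK c Hcm) as B.
    apply Rabs_lt_between in B; apply Rabs_le_between; unfold kappa; lra. }
  (* The mean value point is chosen separately for each [t]; only pointwise bounds on [k] are
     claimed. *)
  destruct (functional_choice _ HKex) as [k Hk'].
  assert (H : s * kappa / 6 <= eta * (s / 3 + 8 * (kappa + eta))).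
  { apply (solvability_estimate (Derive_n y 0) (Derive_n y 1) (Derive_n y 2)
      (Derive_n y 3) (fun t => Rpower (y t) (- (5 / 2))) k eps); trivial.
    - intros t; apply (Hder 0%nat); auto.
    - intros t; apply (Hder 1%nat); auto.
    - intros t; apply (Hder 2%nat); auto.
    - intros t; apply Rlt_le, HF.
      eapply Rlt_le_trans; [apply Hclose | apply Rmin_l].
    - intros t; apply Hk'.
    - intros t; apply Hk'. }
  assert (eta * (s / 3 + 8 * (kappa + eta)) <= eta * A).
  { apply Rmult_le_compat_l; unfold A; lra. }
  lra.
Qed.

Theorem proposition4p1 (m : R) (hm : 0 < m) : ~ bifurcates_from_constant m.
Proof.
  intros [eps [y [Heps [_ [Hy Hconv]]]]].
  destruct (periodic_solution_not_close m hm) as [delta [Hdelta H]].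
  destruct (Hconv delta Hdelta) as [N HN].
  destruct (Hy N) as [Hsol [Hper _]].
  exact (H (eps N) (y N) (proj1 (Heps N)) Hsol Hper (HN N (le_n N))).
Qed.
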